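(* Let $G$ and $H$ be countable discrete groups equipped with proper left-invariant metrics. Suppose that $G$ has finite asymptotic dimension and satisfies the $(m,0)$-DTUT property for some $m\in\mathbb{N}$. Suppose that $H$ is an FC-group with finite asymptotic dimension. Let $W$ be a wreath-like product of $G$ and $H$ corresponding to an action $H\curvearrowright I$ with finitely many orbits, given by the extension $$1\longrightarrow \bigoplus_{i\in I}G\longrightarrow W\stackrel{\varepsilon}{\longrightarrow} H\longrightarrow 1.$$ Suppose $T$ is a symmetric transversal associated with $\bigoplus_{I}G\lhd W$ such that the transversal map $\eta:H\to T$ is unital and bornologous. Equip $W$ with a proper left-invariant metric associated with $T$. Then $\operatorname{trasdim}(W)\le \omega\cdot m+\operatorname{asdim}(H)$, and hence $W$ has asymptotic property C.
   Context: $\mathbb{N}=\{0,1,2,\dots\}$, $\mathbb{N}^+=\{1,2,\dots\}$; $\omega$ is the smallest infinite ordinal. A metric is proper if closed balls are compact. An FC-group is a group all of whose conjugacy classes are finite. Families of subsets. For a metric space $(X,d)$ and $U,V\subseteq X$, $d(U,V)=\inf\{d(x,y)\mid x\in U,y\in V\}$. A family $\mathcal{U}$ of subsets is $R$-bounded if every member has diameter $\le R$, uniformly bounded if it is $R$-bounded for some $R>0$, and $r$-disjoint if $d(U,V)\ge r$ for all distinct $U,V\in\mathcal{U}$. $\bigcup\mathcal{U}$ denotes the union of all members; a family covers $X$ if $\bigcup\mathcal U=X$; unions $\mathcal{U}_1\cup\mathcal{U}_2$, $\bigcup_i\mathcal{U}_i$ of families are families consisting of all their members. Asymptotic dimension.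 $\operatorname{asdim}(X)\le n$ if for every $r>0$ there are uniformly bounded $r$-disjoint families $\mathcal{U}_0,\dots,\mathcal{U}_n$ whose union covers $X$; $\operatorname{asdim}(X)$ is the least such $n$ (finite asymptotic dimension means such $n$ exists). Asymptotic property C. $X$ has it if for every infinite sequence $R_0<R_1<\cdots$ of positive numbers there exist $n\in\mathbb{N}$ and uniformly bounded families $\mathcal{U}_0,\dots,\mathcal{U}_n$ with $\mathcal{U}_i$ being $R_i$-disjoint and $\bigcup_{i=0}^n\mathcal{U}_i$ covering $X$. Transfinite asymptotic dimension. Let $\mathrm{Fin}\,\mathbb{N}$ be the set of finite nonempty subsets of $\mathbb{N}$. For $M\subset \mathrm{Fin}\,\mathbb{N}$ and $a\in\mathbb{N}$ let $M^a=\{\tau\in \mathrm{Fin}\,\mathbb{N}\mid \tau\cup\{a\}\in M,\ a\notin\tau\}$. Define $\mathrm{Ord}\,M$ inductively: $\mathrm{Ord}\,M=0$ iff $M=\varnothing$; $\mathrm{Ord}\,M\le\alpha$ iff $\mathrm{Ord}\,M^a<\alpha$ for all $a\in\mathbb{N}$; $\mathrm{Ord}\,M=\alpha$ iff $\mathrm{Ord}\,M\le\alpha$ and not $\mathrm{Ord}\,M<\alpha$; $\mathrm{Ord}\,M=\infty$ if $\mathrm{Ord}\,M\le\alpha$ holds for no ordinal $\alpha$. Let $A(X,d)$ be the set of $\sigma\in \mathrm{Fin}\,\mathbb{N}$ for which there are no uniformly bounded families $\mathcal{U}_i$ $(i\in\sigma)$ with each $\mathcal{U}_i$ $i$-disjoint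 and $\bigcup_{i\in\sigma}\mathcal{U}_i$ covering $X$. Then $\operatorname{trasdim}(X)=\mathrm{Ord}\,A(X,d)$. DTUT property. For $m,n\in\mathbb{N}$, a metric space $X$ has the $(m,n)$-DTUT property (''disjointness of the $(m,n)$-tiling through uniform translation'') if there exist integers $F_1,\dots,F_m\in\mathbb{N}$ depending only on $X$ such that for every map $h:\mathbb{N}^+\to\mathbb{N}^+$, every sequence $k_0<k_1<\cdots<k_m$ in $\mathbb{N}^+$, and each vector $\vec l=(l_1,\dots,l_m)\in\prod_{r=1}^m\{1,\dots,h(k_r)\}$ there exist uniformly bounded families $\mathcal{C}_0^{\vec l},\dots,\mathcal{C}_n^{\vec l}$ and $\mathcal{D}_{i,0}^{\vec l},\dots,\mathcal{D}_{i,F_i}^{\vec l}$ $(1\le i\le m)$ of subsets of $X$ such that: (i) for every $\vec l$, each $\mathcal{C}_j^{\vec l}$ is $k_0$-disjoint, each $\mathcal{D}_{i,s}^{\vec l}$ is $k_i$-disjoint, and all these families (for the fixed $\vec l$) together cover $X$; (ii) for each $1\le i\le m$, $0\le s\le F_i$ and each fixed $(l_1,\dots,l_{i-1},l_{i+1},\dots,l_m)$: for all $1\le t<t'\le h(k_i)$ the sets $\bigcup\mathcal{D}_{i,s}^{l_1,\dots,l_{i-1},t,l_{i+1},\dots,l_m}$ and $\bigcup\mathcal{D}_{i,s}^{l_1,\dots,l_{i-1},t',l_{i+1},\dots,l_m}$ are non-empty and disjoint, and the family $\bigcup_{t=1}^{h(k_i)}\mathcal{D}_{i,s}^{l_1,\dots,l_{i-1},t,l_{i+1},\dots,l_m}$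 is $k_i$-disjoint. Wreath-like product. Given groups $G,H$ and a (left) action of $H$ on a set $I$, a group $W$ is a wreath-like product of $G$ and $H$ corresponding to $H\curvearrowright I$ if it is an extension $1\to\bigoplus_{i\in I}G_i\to W\stackrel{\varepsilon}{\to}H\to1$ with $G_i\cong G$ and $wG_iw^{-1}=G_{\varepsilon(w).i}$ for all $w\in W$, $i\in I$. Transversals. A transversal $T$ associated with $N=\bigoplus_IG\lhd W$ is a set containing exactly one element of each coset of $N$; it is symmetric if $1_W\in T$ and $T=T^{-1}$. The transversal map $\eta:H\to T$ is the bijection induced by $W/N\cong H$ (so $\varepsilon\eta(h)=h$); it is unital if $\eta(1_H)=1_W$. Each $w\in W$ is uniquely $n\eta(h)$ and is written $(n,h)$, $n\in N$, $h\in H$; $e$ denotes the unit of $N$. A map $f:X\to Y$ of metric spaces is bornologous if for all $R>0$ there is $P(R)>0$ such that $d_X(x,x')<R$ implies $d_Y(f(x),f(x'))<P(R)$; here $\eta$ is viewed as a map $(H,d_H)\to(W,d_W)$. Metric on $W$ associated with $T$. Proper left-invariant metrics on countable groups are taken to be (weighted) word metrics, with length functions $l_G,l_H$ with respect to generating sets $S_G,S_H$ (if the generating set is infinite, the weights are proper, i.e. for every $N$ only finitely many generators have weight at most $N$). Fix a point $i_{\alpha,0}$ in each $H$-orbit $I_\alpha\subseteq I$. For $b\in G$, $\delta^b_i\in\bigoplus_IG$ takes value $b$ at $i$ and $1_G$ elsewhere. The metric $d_W$ associated with $T$ is the weighted word metric for the generating set $\{(\delta^{s}_{i_{\alpha,0}},1_H),(e,h)\mid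 s\in S_G,\ h\in H,\ \alpha \text{ an orbit index}\}$, where $(\delta^s_{i_{\alpha,0}},1_H)$ has weight $l_G(s)$ and $(e,h)=\eta(h)$ has weight $l_H(h)$. *)

(* Defs.v *)
From HB Require Import structures.
From mathcomp Require Import all_boot all_order all_algebra finmap.
From mathcomp Require Import all_classical all_reals ereal.

Set Implicit Arguments.
Unset Strict Implicit.
Unset Printing Implicit Defensive.

Import Order.TTheory GRing.Theory Num.Theory.

Local Open Scope classical_set_scope.
Local Open Scope ring_scope.

(* [lsup f] stands for the least ordinal strictly above all the [f j].  Every
   ordinal is of this form (take for [f] an enumeration of its predecessors),
   and an ordinal is [< lsup f] iff it is [<= f j] for some [j]. *)

Inductive ord : Type := lsup (J : Type) (f : J -> ord).

Definition idx (a : ord) : Type := let: lsup J _ := a in J.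

Definition below (a : ord) : idx a -> ord :=
  match a with lsup _ f => f end.

Definition ozero : ord := lsup (fun x : False => match x with end).
Definition osucc (a : ord) : ord := lsup (fun _ : unit => a).
Definition onat (n : nat) : ord := iter n osucc ozero.
Definition omega : ord := lsup onat.

(* a + b is the least ordinal above all c < a and all a + d with d < b *)
Fixpoint oadd (a b : ord) : ord :=
  let: lsup J f := b in
  lsup (fun x : idx a + J =>
    match x with inl i => below i | inr j => oadd a (f j) end).

(* a * b is the least ordinal above all a * d + c with d < b and c < a *)
Fixpoint omul (a b : ord) : ord :=
  let: lsup J f := b in
  lsup (fun x : J * idx a => oadd (omul a (f x.1)) (below x.2)).

Definition link (M : set {fset nat}) (a : nat) : set {fset nat} :=
  [set tau | [/\ tau != fset0, M (a |` tau)%fset & a \notin tau]].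

(* Ord M <= alpha.  The first disjunct only matters for alpha = 0; in the
   second one, [exists j, Ord_le (f j) (link M a)] says Ord (M^a) < alpha. *)
Fixpoint Ord_le (alpha : ord) (M : set {fset nat}) : Prop :=
  let: lsup J f := alpha in
  M = set0 \/ forall a : nat, exists j : J, Ord_le (f j) (link M a).

Section Coarse.
Context {R : realType} {X : Type} (d : X -> X -> R).

(* Distances and diameters are taken in \bar R: an empty set is at distance
   +oo from every set and has diameter -oo. *)
Definition set_dist (U V : set X) : \bar R :=
  ereal_inf [set (d p.1 p.2)%:E | p in U `*` V].

Definition diam (U : set X) : \bar R :=
  ereal_sup [set (d p.1 p.2)%:E | p in U `*` U].

Definition bounded_by (r : R) (F : set (set X)) : Prop :=
  forall U, F U -> (diam U <= r%:E)%E.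

Definition uniformly_bounded (F : set (set X)) : Prop :=
  exists2 r : R, 0 < r & bounded_by r F.

Definition disjoint_family (r : R) (F : set (set X)) : Prop :=
  forall U V, F U -> F V -> U <> V -> (r%:E <= set_dist U V)%E.

Definition Union (F : set (set X)) : set X := \bigcup_(U in F) U.

Definition covers (F : set (set X)) : Prop := Union F = [set: X].

Definition asdim_le (n : nat) : Prop :=
  forall r : R, 0 < r -> exists U : 'I_n.+1 -> set (set X),
    (forall i, uniformly_bounded (U i) /\ disjoint_family r (U i)) /\
    covers (\bigcup_i U i).

Definition finite_asdim : Prop := exists n, asdim_le n.

Definition asdim_eq (n : nat) : Prop :=
  asdim_le n /\ forall k, asdim_le k -> (n <= k)%N.

Definition asymptotic_property_C : Prop :=
  forall r : nat -> R, (forall i, 0 < r i) ->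
    (forall i j, (i < j)%N -> r i < r j) ->
    exists (n : nat) (U : 'I_n.+1 -> set (set X)),
      (forall i, uniformly_bounded (U i) /\ disjoint_family (r i) (U i)) /\
      covers (\bigcup_i U i).

Definition A_sets : set {fset nat} :=
  [set sigma | sigma != fset0 /\
    ~ exists U : nat -> set (set X),
        (forall i, i \in sigma ->
           uniformly_bounded (U i) /\ disjoint_family i%:R (U i)) /\
        covers (\bigcup_(i in [set` sigma]) U i)].

Definition trasdim_le (alpha : ord) : Prop := Ord_le alpha A_sets.

Definition replace_at m (l : {ffun 'I_m -> nat}) (i : 'I_m) (t : nat) :
  {ffun 'I_m -> nat} := [ffun j => if j == i then t else l j].

(* The indices 1..m of F, l and D are shifted to 'I_m; accordingly k_i becomes
   [k (lift ord0 i)] while k_0 is [k ord0].  Fixing all coordinates of l but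
   the i-th amounts to overwriting the i-th coordinate by [replace_at]. *)
Definition DTUT (m n : nat) : Prop :=
  exists F : 'I_m -> nat,
  forall (h : nat -> nat) (k : 'I_m.+1 -> nat),
    (forall x, (0 < x)%N -> (0 < h x)%N) ->
    (0 < k ord0)%N -> (forall i j : 'I_m.+1, (i < j)%N -> (k i < k j)%N) ->
  let kS (i : 'I_m) := k (lift ord0 i) in
  let admissible (l : {ffun 'I_m -> nat}) :=
    forall r : 'I_m, (1 <= l r <= h (kS r))%N in
  exists (C : {ffun 'I_m -> nat} -> 'I_n.+1 -> set (set X))
         (D : {ffun 'I_m -> nat} -> forall i : 'I_m,
                'I_(F i).+1 -> set (set X)),
    (forall l, admissible l ->
      [/\ forall j, uniformly_bounded (C l j) /\
                    disjoint_family (k ord0)%:R (C l j),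
          forall i s, uniformly_bounded (D l i s) /\
                      disjoint_family (kS i)%:R (D l i s)
        & covers ((\bigcup_j C l j) `|` (\bigcup_i \bigcup_s D l i s))]) /\
    (forall (i : 'I_m) (s : 'I_(F i).+1) l, admissible l ->
      (forall t t', (1 <= t)%N -> (t < t')%N -> (t' <= h (kS i))%N ->
        [/\ Union (D (replace_at l i t) i s) !=set0,
            Union (D (replace_at l i t') i s) !=set0
          & Union (D (replace_at l i t) i s) `&`
            Union (D (replace_at l i t') i s) = set0]) /\
      disjoint_family (kS i)%:R
        (\bigcup_(t in [set t | (1 <= t <= h (kS i))%N])
           D (replace_at l i t) i s)).

End Coarse.

Definition bornologous {R : realType} {X Y : Type} (dX : X -> X -> R)
    (dY : Y -> Y -> R) (f : X -> Y) : Prop :=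
  forall r : R, 0 < r -> exists2 p : R, 0 < p &
    forall x x', dX x x' < r -> dY (f x) (f x') < p.

Section WordMetric.
Context {R : realType} {G : groupType}.

(* [A] is a set of pairs (generator, weight).  The words spelling [g] have
   letters that are generators or inverses of generators. *)
Definition words (A : set (G * R)) (g : G) : set (seq (G * R)) :=
  [set s | (forall p, p \in s -> A p \/ A ((p.1)^-1%g, p.2)) /\
           (\prod_(p <- s) p.1)%g = g].

Definition word_length (A : set (G * R)) (g : G) : R :=
  inf [set \sum_(p <- s) p.2 | s in words A g].

Definition word_dist (A : set (G * R)) (x y : G) : R :=
  word_length A (x^-1 * y)%g.

Definition weighted (S : set G) (w : G -> R) : set (G * R) :=
  [set (s, w s) | s in S].

(* Exactly the data whose word metrics are the proper left-invariant metrics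
   inducing the discrete topology: conversely such a metric d is the word
   metric of S = G with weights w g = d 1 g. *)
Definition proper_weighted_generators (S : set G) (w : G -> R) : Prop :=
  [/\ forall g, words (weighted S w) g !=set0,
      forall s, S s -> 0 <= w s,
      forall s, S s -> w s = 0 -> s = 1%g
    & forall N : R, finite_set [set s | S s /\ w s <= N]].

End WordMetric.

Definition FC_group (H : groupType) : Prop :=
  forall x : H, finite_set [set (g * x * g^-1)%g | g in [set: H]].

Definition dsum (I : choiceType) (G : groupType) : Type :=
  {fsfun I -> G with 1%g}.

Section Dsum.
Context {I : choiceType} {G : groupType}.
Implicit Types f g h : dsum I G.

Definition dsum_one : dsum I G := [fsfun with 1%g].
Definition dsum_inv f : dsum I G :=
  [fsfun i in finsupp f => (f i)^-1%g | 1%g].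
Definition dsum_mul f g : dsum I G :=
  [fsfun i in (finsupp f `|` finsupp g)%fset => (f i * g i)%g | 1%g].

Lemma dsum_oneE i : dsum_one i = 1%g.
Proof. by rewrite fsfunE. Qed.

Lemma dsum_invE f i : dsum_inv f i = (f i)^-1%g.
Proof.
by rewrite fsfunE; case: finsuppP => // _; rewrite invg1.
Qed.

Lemma dsum_mulE f g i : dsum_mul f g i = (f i * g i)%g.
Proof.
rewrite fsfunE in_fsetU; case: finsuppP => //= _.
by case: finsuppP => //= _; rewrite mulg1.
Qed.

HB.instance Definition _ := Choice.on (dsum I G).

Fact dsum_mulA : associative dsum_mul.
Proof. by move=> f g h; apply/fsfunP => i; rewrite !dsum_mulE mulgA. Qed.
Fact dsum_mul1 : left_id dsum_one dsum_mul.
Proof. by move=> f; apply/fsfunP => i; rewrite !dsum_mulE dsum_oneE mul1g. Qed.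
Fact dsum_mulr1 : right_id dsum_one dsum_mul.
Proof. by move=> f; apply/fsfunP => i; rewrite !dsum_mulE dsum_oneE mulg1. Qed.
Fact dsum_mulV : left_inverse dsum_one dsum_inv dsum_mul.
Proof.
by move=> f; apply/fsfunP=> i; rewrite !dsum_mulE dsum_invE dsum_oneE mulVg.
Qed.
Fact dsum_mulrV : right_inverse dsum_one dsum_inv dsum_mul.
Proof.
by move=> f; apply/fsfunP=> i; rewrite !dsum_mulE dsum_invE dsum_oneE mulgV.
Qed.

HB.instance Definition _ := isGroup.Build (dsum I G)
  dsum_mulA dsum_mul1 dsum_mulr1 dsum_mulV dsum_mulrV.

Definition delta (i : I) (b : G) : dsum I G :=
  [fsfun dsum_one with i |-> b].

End Dsum.

Section WreathLike.
Context {R : realType} {G H W : groupType} {I : choiceType}.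
Variables (act : H -> I -> I).
Variables (iota : {multiplicative dsum I G -> W}).
Variables (eps : {multiplicative W -> H}).

Definition is_left_action : Prop :=
  (forall i, act 1%g i = i) /\
  (forall g h i, act (g * h)%g i = act g (act h i)).

Definition summand (i : I) : set W := [set iota (delta i b) | b in [set: G]].

Definition wreath_like_product : Prop :=
  [/\ injective iota,
      range iota = [set w | eps w = 1%g],
      range eps = [set: H]
    & forall w i,
        [set (w * x * w^-1)%g | x in summand i] = summand (act (eps w) i)].

Definition coset_transversal (T : set W) : Prop :=
  forall w, exists! t, T t /\ range iota (w^-1 * t)%g.

Definition symmetric_set (T : set W) : Prop :=
  T 1%g /\ [set (t^-1)%g | t in T] = T.

(* The inverse of the bijection T -> W/N = H induced by eps. *)
Definition transversal_map (T : set W) (eta : H -> W) : Prop :=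
  forall h, T (eta h) /\ eps (eta h) = h.

Definition unital (eta : H -> W) : Prop := eta 1%g = 1%g.

(* Exactly one base point in each orbit; in particular there are only
   finitely many orbits, indexed by 'I_q. *)
Definition orbit_base_points (q : nat) (base : 'I_q -> I) : Prop :=
  forall i, exists! a : 'I_q, exists h, act h (base a) = i.

(* The element written (n, h) in coordinates. *)
Definition wreath_elt (eta : H -> W) (n : dsum I G) (h : H) : W :=
  (iota n * eta h)%g.

Definition wreath_generators (eta : H -> W) (q : nat) (base : 'I_q -> I)
    (SG : set G) (lG : G -> R) (lH : H -> R) : set (W * R) :=
  [set x | exists a s,
     SG s /\ x = (wreath_elt eta (delta (base a) s) 1%g, lG s)] `|`
  [set (wreath_elt eta 1%g h, lH h) | h in [set: H]].

End WreathLike.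

(* Main.v *)
Require Import Defs.
From HB Require Import structures.
From mathcomp Require Import all_boot all_order all_algebra finmap.
From mathcomp Require Import all_classical all_reals ereal.
From mathcomp Require Import zify.

(* Finite subsets of the groups replace their metrics: a decomposition of a
   group X becomes a colouring of X whose classes are cut into cells, the
   cells being bounded and, within a colour, separated with respect to a finite
   set of translations.

   Given a scale r0, cut H into n + 1 = asdim H + 1 families of r0-disjoint
   bounded cells.  Over such a cell, translations of length r0 change the
   coordinates of the base group only in a finite window, a translate of a
   fixed finite subset of I, so that one has to decompose finite powers of G.
   At a second scale r1 >= r0, each coordinate i of the window is decomposed
   by nested layers around large cells of G (there are d + 1 colours of cells,
   d >= asdim G): cutting the layers at suitable levels yields r0-disjoint
   cells, plus a set of cuts which must be covered by r1-disjoint families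
   whose number depends on r0 only.

   The difficulty is that over nearby cells of H the windows differ.  As H is
   an FC-group, boundedly many colours (depending on r0 only) make every window
   rainbow.  As in the hat puzzle where each player sees all the hats but his
   own, a window chooses the level at which its coordinate of a given colour
   is cut so that the sum of the layer functions over all coordinates of this
   colour equals, modulo a large integer, a code of the window and of the
   coordinates outside it.  This sum hardly varies at scale r1, hence cuts with
   different codes are r1-disjoint, and cuts with the same code lie in a single
   finite power of G.

   Thus W is covered by n + 1 families that are r0-disjoint and K(r0) families
   that are r1-disjoint, where K = 0 if d = 0.  This gives
   trasdim W <= omega + n, and trasdim W <= n if d = 0; the latter is the case
   m = 0, because (0,0)-DTUT means asdim G <= 0. *)

Local Open Scope classical_set_scope.

(** * Decompositions of groups *)

Section Groups.
Set Implicit Arguments.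
Unset Strict Implicit.
Local Open Scope group_scope.

(** The metric-free form of [asdim_le]: [ctr g] names the cell of [g], the finite set [B] bounds all
    cells, and [E] stands for a ball of the disjointness radius. *)
Definition group_asdim_le (G : groupType) (n : nat) : Prop :=
  forall E : seq G, exists (col : G -> 'I_n.+1) (ctr : G -> G) (B : seq G),
    (forall g, (ctr g)^-1 * g \in B) /\
    (forall g g', col g = col g' -> g^-1 * g' \in E -> ctr g = ctr g').

Fixpoint word_ball (G : groupType) (Q : seq G) (k : nat) : seq G :=
  if k is k'.+1 then
    word_ball Q k' ++ [seq x * q | x <- word_ball Q k', q <- Q]
  else [:: 1].

Lemma word_ball_le (G : groupType) (Q : seq G) k l :
  (k <= l)%N -> {subset word_ball Q k <= word_ball Q l}.
Proof.
elim: l => [|l IH]; first by rewrite leqn0 => /eqP ->.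
rewrite leq_eqVlt => /predU1P[-> //|/IH kl] x /kl xl.
by rewrite mem_cat xl.
Qed.

Lemma word_ballM (G : groupType) (Q : seq G) k x q :
  x \in word_ball Q k -> q \in Q -> x * q \in word_ball Q k.+1.
Proof.
by move=> xk qQ /=; rewrite mem_cat; apply/orP; right; apply: allpairs_f.
Qed.

(* [phi s g] is the [Q]-distance from [g] to the colour class [s], truncated
   at [L]. *)
Lemma layers (G : groupType) n : group_asdim_le G n ->
  forall (Q : seq G) (L : nat),
  exists (phi : 'I_n.+1 -> G -> nat) (c : 'I_n.+1 -> G -> G) (B : seq G),
  [/\ forall g, exists s, phi s g = 0%N,
      forall s g g', g^-1 * g' \in Q -> (phi s g' <= (phi s g).+1)%N,
      forall s g g', (phi s g < L)%N -> (phi s g' < L)%N ->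
        g^-1 * g' \in Q -> c s g = c s g'
    & forall s g, (phi s g < L)%N -> (c s g)^-1 * g \in B].
Proof.
move=> asG Q L; set W := word_ball Q.
(* With this [E], no [Q]-step joins the [W L]-thickenings of different cells of one colour. *)
pose E := [seq x * y^-1 | x <- [seq x * q | x <- W L, q <- Q], y <- W L].
have [col [ctr [B [ctrB ctrE]]]] := asG E.
pose near s t g := exists2 u, col u = s & u^-1 * g \in W t.
pose phi s g := find (fun t => `[<near s t g>]) (iota 0 L).
have phi_le s g : (phi s g <= L)%N.
  by rewrite -[X in (_ <= X)%N](size_iota 0 L) find_size.
have near_phi s g : (phi s g < L)%N -> near s (phi s g) g.
  move=> lt; have h : has (fun t => `[<near s t g>]) (iota 0 L).
    by rewrite has_find size_iota.
  by have /asboolP := nth_find 0%N h; rewrite nth_iota.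
have phi_near s t g : (t < L)%N -> near s t g -> (phi s g <= t)%N.
  move=> tL nt; rewrite leqNgt; apply/negP => lt.
  have := before_find 0%N lt; rewrite nth_iota // add0n => /asboolP.
  by apply.
have nearL s g : (phi s g < L)%N -> near s L g.
  move=> lt; have [u us uW] := near_phi _ _ lt; exists u => //.
  by apply: word_ball_le uW; exact: ltnW.
(* The value 1 is taken only beyond the truncation, where nothing is claimed about [c]. *)
pose c s g := if pselect (near s L g) is left h then ctr (s2val (cid2 h))
              else 1.
have cP s g : near s L g ->
    exists u, [/\ col u = s, u^-1 * g \in W L & c s g = ctr u].
  rewrite /c; case: pselect => // h _; case: (cid2 h) => u us uW.
  by exists u.
exists phi, c, [seq b * x | b <- B, x <- W L]; split.
- move=> g; exists (col g); apply/eqP; rewrite -leqn0.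
  have [L0|L0] := posnP L; first by rewrite -L0 phi_le.
  by apply: phi_near => //; exists g => //; rewrite mulVg /= inE.
- move=> s g g' gQ; have [lt|ge] := ltnP (phi s g) L; last first.
    by apply: leq_trans (phi_le _ _) _; apply: leqW.
  have [lt'|ge] := ltnP (phi s g).+1 L; last exact: leq_trans (phi_le _ _) ge.
  apply: phi_near => //; have [u us uW] := near_phi _ _ lt.
  by exists u => //; rewrite -(mulKg g^-1 g') invgK mulgA; exact: word_ballM.
- move=> s g g' /nearL/cP[u [us uW ->]] /nearL/cP[v [vs vW ->]] gQ.
  apply: ctrE; first by rewrite us vs.
  rewrite (_ : u^-1 * v = (u^-1 * g) * (g^-1 * g') * (v^-1 * g')^-1).
    by apply: allpairs_f => //; apply: allpairs_f.
  by rewrite invgM invgK !mulgA !mulgK.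
move=> s g /nearL/cP[u [us uW ->]].
rewrite (_ : (ctr u)^-1 * g = ((ctr u)^-1 * u) * (u^-1 * g)).
  exact: allpairs_f.
by rewrite mulgA mulgK.
Qed.

(** * Greedy colouring, residues and codes in finite types *)

Lemma greedy_coloring (T : eqType) (D : nat) (nb : T -> seq T) (s : seq T) :
  (forall x, size (nb x) <= D)%N ->
  exists col : T -> 'I_D.+1, {in s &, forall x y, x != y -> y \in nb x ->
    x \in nb y -> col x != col y}.
Proof.
move=> nbD; elim: s => [|x s [col colP]]; first by exists (fun=> ord0).
have [xs|xs] := boolP (x \in s).
  exists col => y z; rewrite !inE => /predU1P ys /predU1P zs.
  by apply: colP; [case: ys => [->|] | case: zs => [->|]].
(* One of [D.+1] colours is free of the at most [D] neighbours; conflicts being mutual, the list of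
   [x] accounts for all conflicts with earlier vertices. *)
have [k kP] : exists k, k \notin [seq col y | y <- nb x].
  apply/existsP; rewrite -[X in is_true X]negbK negb_exists; apply/negP.
  move=> /forallP h; suff : (D.+1 <= D)%N by rewrite ltnn.
  rewrite -{1}(card_ord D.+1) (leq_trans _ (nbD x)) //.
  rewrite -(size_map col (nb x)) (leq_trans _ (card_size _)) //.
  apply/subset_leq_card/fintype.subsetP => i _.
  by have := h i; rewrite negbK.
exists (fun y => if y == x then k else col y) => y z.
rewrite !inE; case: eqVneq => [->|yx] /=; case: eqVneq => [->|zx] //=.
- by move=> _ _ _ zx' _; apply: contraNneq kP => ->; apply: map_f.
- by move=> _ _ _ _ yx'; apply: contraNneq kP => <-; apply: map_f.
- exact: colP.
Qed.

(** The representative of [p - a] modulo [E] between 1 and [E]; the factor [E.-1] plays the role of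
    -1. *)
Definition residue (E a p : nat) : nat :=
  ((p + a * E.-1 + E.-1) %% E).+1.

Lemma residue_le E a p : (0 < E)%N -> (residue E a p <= E)%N.
Proof. by move=> E0; rewrite /residue ltn_pmod. Qed.

Lemma residueP E a p : (p < E)%N -> ((residue E a p + a) %% E)%N = p.
Proof.
move=> pE; rewrite /residue -addn1 -addnA modnDml.
rewrite (_ : (p + a * E.-1 + E.-1 + (1 + a) = a.+1 * E + p)%N).
  by rewrite modnMDl modn_small.
by case: E pE => // E _ /=; nia.
Qed.

Lemma eq_multiples Z x y : (x <= y + Z)%N -> (y <= x + Z)%N ->
  Z.+1 %| x -> Z.+1 %| y -> x = y.
Proof.
move=> + + /dvdnP[k xE] /dvdnP[l yE]; rewrite {}xE {}yE => kl lk.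
have klE : (k <= l)%N by rewrite -ltnS -(ltn_pmul2r (ltn0Sn Z)); nia.
have lkE : (l <= k)%N by rewrite -ltnS -(ltn_pmul2r (ltn0Sn Z)); nia.
by congr (_ * _)%N; apply/eqP; rewrite eqn_leq klE.
Qed.

Lemma dvdn_of_mod Z E x : (Z %| E -> Z %| x %% E -> Z %| x)%N.
Proof.
move=> ZE Zx; rewrite (divn_eq x E) dvdn_addr //.
by rewrite dvdn_mull.
Qed.

Lemma index_inj_in (T : eqType) (s : seq T) x y :
  x \in s -> index x s = index y s -> x = y.
Proof.
move=> xs eq; have ys : y \in s by rewrite -index_mem -eq index_mem.
by rewrite -(nth_index x xs) eq nth_index.
Qed.

Lemma inord_index_inj (T : eqType) (s : seq T) x y : x \in s -> y \in s ->
  inord (index x s) = inord (index y s) :> 'I_(size s).+1 -> x = y.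
Proof.
move=> xs ys /(congr1 (@nat_of_ord _)); rewrite !inordK ?ltnS ?index_size //.
exact: index_inj_in.
Qed.

Lemma filter_unique (T : eqType) (P : pred T) (s : seq T) x :
  x \in s -> P x -> {in s, forall y, P y -> y = x} ->
  exists r, [seq y <- s | P y] = x :: r.
Proof.
move=> xs Px h; case E: [seq y <- s | P y] => [|y r].
  by have := mem_filter P x s; rewrite E Px xs.
have : y \in [seq y <- s | P y] by rewrite E mem_head.
by rewrite mem_filter => /andP[Py ys]; exists r; rewrite (h y ys Py).
Qed.

(* [a x] and [cc x] are the colour and the cell of (the image in H of) [x] at
   small scale, [e x] and [g x] those at large scale, and [b x] is the position
   of the small cell in the large one.  [nu x] are the coordinates of [x], those
   in the window [win (b x)] being the ones that small steps [near0] can change.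
   The window coordinate [i] is cut at the level where the sum of the layer
   functions over all coordinates of colour [kap i] is [p x] modulo [E].  This
   sum is almost invariant under large steps [near1] while [p x] is a well
   spaced code of [b x] and of the coordinates outside the window. *)
Lemma core_partition (W A C C' : Type) (HB I : choiceType) (G : groupType)
    (d : nat) (K : finType)
    (a : W -> A) (cc : W -> C) (e : W -> A) (g : W -> C') (b : W -> HB)
    (BV : seq HB) (nu : W -> I -> G) (win : HB -> seq I) (S1 : seq I)
    (kap : I -> K) (Q : seq G) (near0 near1 : W -> W -> Prop) :
  group_asdim_le G d ->
  (forall q, q \in Q -> q^-1 \in Q) ->
  uniq S1 ->
  (forall x, b x \in BV) ->
  (forall h, h \in BV -> {subset win h <= S1}) ->
  (forall h, h \in BV -> {in win h &, injective kap}) ->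
  (forall x x', cc x = cc x' -> g x = g x' /\ b x = b x') ->
  (forall x x', near0 x x' -> a x = a x' ->
     [/\ cc x = cc x', forall i, i \notin win (b x) -> nu x i = nu x' i
       & forall i, (nu x i)^-1 * nu x' i \in Q]) ->
  (forall x x', near1 x x' -> e x = e x' ->
     [/\ g x = g x', forall i, i \notin S1 -> nu x i = nu x' i
       & forall i, (nu x i)^-1 * nu x' i \in Q]) ->
  exists (L : Type)
    (col : W -> A + (A * K * 'I_d.+1 * {ffun K -> 'I_d.+1}))
    (lab : W -> L) (BG : seq G),
  [/\ forall x t, col x = inr t -> (0 < d)%N,
      forall x x' t, col x = inl t -> col x' = inl t -> near0 x x' ->
        lab x = lab x',
      forall x x' t, col x = inr t -> col x' = inr t -> near1 x x' ->
        lab x = lab x'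
    & forall x x', col x = col x' -> lab x = lab x' ->
        [/\ g x = g x', b x = b x',
            forall i, i \notin win (b x) -> nu x i = nu x' i
          & forall i, i \in win (b x) -> (nu x i)^-1 * nu x' i \in BG]].
Proof.
move=> asG QV uS1 bBV winS1 rainbow ccP F0 F1.
have [col0 [ctr0 [B0 [ctr0B ctr0Q]]]] := asG Q.
(* A finite colouring that tells distinct [Q]-close points apart: with equal [col0] they share a
   cell, in which their positions differ. *)
pose gcol z := (col0 z, inord (index ((ctr0 z)^-1 * z) B0)
                          : 'I_(size B0).+1).
have gcol_inj z z' : z^-1 * z' \in Q -> gcol z = gcol z' -> z = z'.
  move=> zQ [/ctr0Q/(_ zQ) ctrE] /inord_index_inj.
  by rewrite -ctrE => /(_ (ctr0B _)); rewrite ctrE => /(_ (ctr0B _)) /mulgI.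
pose y x i := if i \in win (b x) then 1 else nu x i.
pose CT := ('I_(size BV).+1 *
            {ffun 'I_(size S1) -> 'I_d.+1 * 'I_(size B0).+1})%type.
pose code x : CT := (inord (index (b x) BV),
                     [ffun j => gcol (y x (tnth (in_tuple S1) j))]).
(* A [Q]-step in every coordinate changes a sum of layer functions over [S1] by at most [Z]; the
   codes are therefore spaced by [Z.+1]. *)
pose Z := size S1.
pose E := (#|{: CT}| * Z.+1)%N.
pose p x := (enum_rank (code x) * Z.+1)%N.
have pE x : (p x < E)%N by rewrite /p /E ltn_pmul2r.
have [phi [c [B [phi0 phiQ cQ cB]]]] := layers asG Q E.+1.
(* A rainbow window has at most one coordinate of colour [k]; if that one lies at level [tau], the
   sum over all coordinates of colour [k] is [p x] modulo [E]. *)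
pose oth k s x := (\sum_(i <- S1 | (kap i == k) && (i \notin win (b x)))
                     phi s (nu x i))%N.
pose tau k s x := residue E (oth k s x) (p x).
have tauE k s x : (tau k s x <= E)%N.
  by apply: residue_le; apply: leq_ltn_trans (pE x).
pose test x i (s : 'I_d.+1) := (s == d :> nat) ||
                     (phi s (nu x i) <= tau (kap i) s x)%N.
(* The first colour within whose level the coordinate lies; the last colour [d] takes the rest,
   where its [phi] is 0 by [phi0]. *)
pose ss x i := [arg min_(s < ord_max | test x i s) (s : nat)].
have ssP x i : test x i (ss x i) /\
    forall s, test x i s -> (ss x i <= s)%N.
  rewrite /ss; case: arg_minnP; first by rewrite /test /= eqxx.
  by move=> s ts h; split.
have phi_ss x i : (phi (ss x i) (nu x i) <= tau (kap i) (ss x i) x)%N.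
  have [t1 t2] := ssP x i; case/orP: (t1) => // /eqP sd.
  have [s0 s0P] := phi0 (nu x i).
  have := t2 s0; rewrite /test s0P leq0n orbT sd => /(_ isT) ds.
  suff -> : ss x i = s0 by rewrite s0P.
  by apply/val_inj => /=; apply/eqP; rewrite eqn_leq {1}sd ds -ltnS sd ltn_ord.
(* Only the colours before the last are cut, so there are no cuts if [d = 0]. *)
pose bad x i := (ss x i < d)%N &&
                (phi (ss x i) (nu x i) == tau (kap i) (ss x i) x).
(* Indexing the window by [kap] makes the type of these colours independent of the window and of its
   position. *)
pose q x : {ffun K -> 'I_d.+1} := [ffun k =>
  if [seq i <- win (b x) | kap i == k] is i :: _ then col0 (nu x i)
  else ord0].
have qE x i : i \in win (b x) -> q x (kap i) = col0 (nu x i).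
  move=> iw; rewrite ffunE.
  have uni : {in win (b x), forall j, kap j == kap i -> j = i}.
    by move=> j jw /eqP ij; exact: rainbow (bBV x) _ _ jw iw ij.
  by have [r ->] := filter_unique iw (eqxx (kap i)) uni.
pose badl x := [seq i <- win (b x) | bad x i].
pose col x := if badl x is i :: _ then inr (e x, kap i, ss x i, q x)
              else inl (a x).
pose cl x i := if i \in win (b x)
  then (ss x i, c (ss x i) (nu x i)) else (ord0, 1).
pose vl x i := if i \in win (b x) then ctr0 (nu x i) else 1.
pose lab x := if badl x is _ :: _ then inr (g x, b x, y x, vl x)
              else inl (cc x, y x, cl x).
have colinl x t : col x = inl t -> [/\ t = a x, badl x = [::] &
    lab x = inl (cc x, y x, cl x)].
  by rewrite /col /lab; case: (badl x) => //= -[->].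
have colinr x t : col x = inr t -> exists i, [/\ i \in win (b x), bad x i,
    t = (e x, kap i, ss x i, q x) &
    lab x = inr (g x, b x, y x, vl x)].
  rewrite /col /lab; case E': (badl x) => [//|i l] [<-].
  exists i; have : i \in badl x by rewrite E' mem_head.
  by rewrite mem_filter => /andP[].
have nuy x x' : b x = b x' -> y x = y x' ->
    forall i, i \notin win (b x) -> nu x i = nu x' i.
  by move=> bb /(congr1 (@^~ _)) yy i iw; have := yy i;
     rewrite /y -bb (negbTE iw).
exists _, col, lab, ([seq u^-1 * v | u <- B, v <- B] ++
                     [seq u^-1 * v | u <- B0, v <- B0]); split.
- move=> x t /colinr[i [_ /andP[h _] _ _]].
  exact: leq_ltn_trans h.
- move=> x x' t /colinl[ta bx ->] /colinl[ta' bx' ->] nx.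
  have [ccE nuE nuQ] := F0 _ _ nx (etrans (esym ta) ta').
  have [_ bE] := ccP _ _ ccE.
  have yE : y x = y x'.
    by apply/funext => i; rewrite /y -bE; case: ifP => // /negbT /nuE.
  have othE k s : oth k s x = oth k s x'.
    by apply: eq_big => [i|i /andP[_ /nuE ->]]; rewrite -?bE.
  have pp : p x = p x' by rewrite /p /code yE bE.
  have tauEE k s : tau k s x = tau k s x' by rewrite /tau othE pp.
  have notbad z i : badl z = [::] -> i \in win (b z) -> ~~ bad z i.
    move=> zb iw; apply/negP => zi.
    by have := mem_filter (bad z) i (win (b z)); rewrite -/(badl z) zb zi iw.
  (* Off the cuts [phi] is strictly below the level, so a [Q]-step stays within it; used in both
     directions, this makes [ss] constant. *)
  have key z z' i : (nu z i)^-1 * nu z' i \in Q ->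
      (forall s, tau (kap i) s z = tau (kap i) s z') -> ~~ bad z i ->
      (ss z' i <= ss z i)%N.
    move=> zQ tz nb; apply: (ssP z' i).2; rewrite /test.
    have [sd|/= sd] := boolP (ss z i == d :> nat); first by [].
    have sd' : (ss z i < d)%N by rewrite ltn_neqAle sd -ltnS ltn_ord.
    move: nb; rewrite /bad sd' /= => nb.
    rewrite -tz (leq_trans (phiQ _ _ _ zQ)) //.
    by rewrite ltn_neqAle nb phi_ss.
  rewrite ccE yE; congr (inl (_, _, _)); apply/funext => i; rewrite /cl -bE.
  case: ifP => // iw.
  have iw' : i \in win (b x') by rewrite -bE.
  have nuQ' : (nu x' i)^-1 * nu x i \in Q.
    by rewrite -[_ * _]invgK invgM invgK QV.
  have sE : ss x i = ss x' i.
    by apply/val_inj/eqP; rewrite eqn_leq /= !key ?notbad.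
  rewrite -sE; congr (_, _); apply: cQ => //; rewrite ltnS.
    exact: leq_trans (phi_ss _ _) _.
  by rewrite sE (leq_trans (phi_ss _ _)).
- move=> x x' t /colinr[i [iw bi tE ->]] /colinr[i' [iw' bi' tE' ->]] nx.
  move: tE' bi'; rewrite tE => -[ee kk sss qq] bi'.
  have [gE nuE nuQ] := F1 _ _ nx ee.
  have nuQ' j : (nu x' j)^-1 * nu x j \in Q.
    by rewrite -[_ * _]invgK invgM invgK QV.
  pose Phi z := (\sum_(j <- S1 | kap j == kap i) phi (ss x i) (nu z j))%N.
  have PhiE z j : j \in win (b z) -> bad z j -> kap j = kap i ->
      ss z j = ss x i -> (Phi z %% E = p z)%N.
    move=> jw /andP[_ /eqP jb] kj sj; rewrite /Phi.
    rewrite big_mkcond (bigD1_seq j) ?(winS1 _ (bBV z)) ?kj ?eqxx //=.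
    rewrite -big_mkcondr.
    rewrite (eq_bigl (fun l => (kap l == kap i) && (l \notin win (b z)))).
      by rewrite -sj jb -kj sj -/(oth _ _ _) residueP.
    move=> l; rewrite andbC; case: eqP => //= kl.
    case: eqVneq => [->|lj]; first by rewrite jw.
    apply/esym; apply/negP => lw; case/eqP: lj.
    by apply: rainbow (bBV z) _ _ lw jw _; rewrite kl kj.
  have PhiL z z' : (forall j, (nu z j)^-1 * nu z' j \in Q) ->
      (Phi z' <= Phi z + Z)%N.
    move=> zQ; rewrite /Phi /Z -sum1_size.
    rewrite 2!(big_mkcond (fun j => kap j == kap i)) -big_split /=.
    by apply: leq_sum => j _; case: ifP => // _; rewrite addn1 phiQ.
  have PhiZ z : (Phi z %% E = p z)%N -> Z.+1 %| Phi z.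
    by move=> h; apply: (@dvdn_of_mod _ E); rewrite ?h /E /p dvdn_mull.
  have P1 := PhiE x i iw bi erefl erefl.
  have P2 := PhiE x' i' iw' bi' (esym kk) (esym sss).
  (* Both sums are multiples of [Z.+1] and differ by at most [Z], so they agree, and their residues
     modulo [E] give equal codes. *)
  have PP := eq_multiples (PhiL _ _ nuQ') (PhiL _ _ nuQ)
                          (PhiZ _ P1) (PhiZ _ P2).
  have pp : p x = p x' by rewrite -P1 -P2 PP.
  move/eqP: pp; rewrite /p eqn_pmul2r // => /eqP/val_inj/enum_rank_inj.
  move=> [/inord_index_inj -/(_ (bBV _) (bBV _)) bE /ffunP codeE].
  have yE : y x = y x'.
    apply/funext => j; have [jS|jS] := boolP (j \in S1); last first.
      by rewrite /y -bE nuE.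
    have jS' : (index j S1 < size S1)%N by rewrite index_mem.
    have := codeE (Ordinal jS'); rewrite !ffunE !(tnth_nth j) /= nth_index //.
    rewrite /y -bE; case: ifP => // _; exact: gcol_inj.
  rewrite gE bE yE; congr (inr (_, _, _, _)).
  apply/funext => j; rewrite /vl -bE; case: ifP => // jw.
  apply: ctr0Q => //; rewrite -!qE ?qq -?bE //.
move=> x x'; case E1: (col x) => [t|t] => /esym E2.
  have [_ _ ->] := colinl _ _ E1; have [_ _ ->] := colinl _ _ E2.
  move=> [cE yE clE]; have [gE bE] := ccP _ _ cE; split => //; first exact: nuy.
  move=> i iw; rewrite mem_cat; apply/orP; left.
  move/(congr1 (@^~ i)): clE; rewrite /cl -bE iw => -[sE cE'].
  rewrite (_ : _ * _ = ((c (ss x i) (nu x i))^-1 * nu x i)^-1 *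
                       ((c (ss x' i) (nu x' i))^-1 * nu x' i)).
    by apply: allpairs_f; apply: cB; rewrite ltnS (leq_trans (phi_ss _ _)).
  by rewrite -cE' invgM invgK !mulgA mulgK.
have [? [_ _ _ ->]] := colinr _ _ E1; have [? [_ _ _ ->]] := colinr _ _ E2.
move=> [gE bE yE vE]; split => //; first exact: nuy.
move=> i iw; rewrite mem_cat; apply/orP; right.
move/(congr1 (@^~ i)): vE; rewrite /vl -bE iw => cE.
rewrite (_ : _ * _ = ((ctr0 (nu x i))^-1 * nu x i)^-1 *
                     ((ctr0 (nu x' i))^-1 * nu x' i)).
  exact: allpairs_f.
by rewrite -cE invgM invgK !mulgA mulgK.
Qed.

(** * Direct sums and wreath-like extensions *)

Section Multiplicative.
Context {G H : groupType} (f : {multiplicative G -> H}).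

Lemma mult1 : f 1 = 1.
Proof. by apply: (mulgI (f 1)); rewrite -gmulfM !mulg1. Qed.

Lemma multV x : f x^-1 = (f x)^-1.
Proof. by apply: (mulgI (f x)); rewrite -gmulfM !mulgV mult1. Qed.

End Multiplicative.

Section Dsums.
Context {I : choiceType} {G : groupType}.
Implicit Types f : dsum I G.

Lemma deltaE (i : I) (g : G) k : delta i g k = if k == i then g else 1.
Proof. by rewrite /delta fsfun_withE dsum_oneE. Qed.

Lemma delta1 (i : I) : delta i 1 = 1 :> dsum I G.
Proof. by apply/fsfunP => k; rewrite deltaE dsum_oneE if_same. Qed.

Lemma deltaM (i : I) (g h : G) : delta i (g * h) = delta i g * delta i h.
Proof.
by apply/fsfunP => k; rewrite dsum_mulE !deltaE; case: eqP; rewrite ?mulg1.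
Qed.

Lemma dsum_mulgE f f' i : (f * f') i = f i * f' i.
Proof. exact: dsum_mulE. Qed.

Lemma dsum_invgE f i : f^-1 i = (f i)^-1.
Proof. exact: dsum_invE. Qed.

Lemma dsum1gE i : (1 : dsum I G) i = 1.
Proof. exact: dsum_oneE. Qed.

(** Each step splits off the coordinate at the head of the list and resets it to 1, so any list
    containing the support can drive the induction. *)
Lemma dsum_list_ind (P : seq I -> dsum I G -> Prop) :
  P [::] 1 ->
  (forall i s (g : G) f, f i = 1 -> P s f -> P (i :: s) (delta i g * f)) ->
  forall s f, (forall i, i \notin s -> f i = 1) -> P s f.
Proof.
move=> P1 PS; elim=> [|i s IH] f fs.
  by have -> : f = 1 by apply/fsfunP => i; rewrite fs // dsum1gE.
have -> : f = delta i (f i) * (delta i (f i)^-1 * f).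
  by rewrite mulgA -deltaM mulgV delta1 mul1g.
have f'i k : (delta i (f i)^-1 * f) k = if k == i then 1 else f k.
  by rewrite dsum_mulgE deltaE; case: eqP => [->|]; rewrite ?mulVg ?mul1g.
apply: PS; first by rewrite f'i eqxx.
apply: IH => k ks; rewrite f'i; case: eqP => // /eqP ki.
by apply: fs; rewrite inE negb_or ki.
Qed.

Lemma dsum_ind (P : dsum I G -> Prop) :
  P 1 -> (forall i (g : G) f, f i = 1 -> P f -> P (delta i g * f)) ->
  forall f, P f.
Proof.
move=> P1 PS f.
have h i : i \notin (finsupp f : seq I) -> f i = 1 by exact: fsfun_dflt.
exact: (@dsum_list_ind (fun _ => P) P1 (fun i _ => PS i) _ _ h).
Qed.

Lemma dsum_finite (s : seq I) (V : seq G) :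
  exists F : seq (dsum I G), forall f,
    (forall i, i \notin s -> f i = 1) -> (forall i, f i \in 1 :: V) -> f \in F.
Proof.
exists (foldr (fun i F => [seq delta i v * f | v <- 1 :: V, f <- F]) [:: 1] s).
move=> f fs.
elim/dsum_list_ind: s f / fs => [|i s g f fi IH] h; first by rewrite inE.
apply: allpairs_f.
  by have := h i; rewrite dsum_mulgE deltaE eqxx fi mulg1.
apply: IH => k; have := h k; rewrite dsum_mulgE deltaE.
by case: eqP => [->|_]; rewrite ?fi ?mem_head ?mul1g.
Qed.

End Dsums.

Section Extension.
Context {G H W : groupType} {I : choiceType} {act : H -> I -> I}.
Context {iota : {multiplicative dsum I G -> W}}.
Context {eps : {multiplicative W -> H}}.
Hypothesis wreathW : wreath_like_product act iota eps.

Lemma eps_iota (f : dsum I G) : eps (iota f) = 1.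
Proof.
case: wreathW => _ r _ _; have : range iota (iota f) by exists f.
by rewrite r.
Qed.

Lemma eps_ker w : eps w = 1 -> exists f, iota f = w.
Proof.
move=> ew; case: wreathW => _ r _ _.
by have : range iota w by [rewrite r]; case=> f _ <-; exists f.
Qed.

Lemma conj_delta w i (g : G) :
  exists g', w * iota (delta i g) * w^-1 = iota (delta (act (eps w) i) g').
Proof.
case: wreathW => _ _ _ /(_ w i) E.
have : [set w * x * w^-1 | x in summand iota i] (w * iota (delta i g) * w^-1).
  by exists (iota (delta i g)) => //; exists g.
by rewrite E => -[g' _ <-]; exists g'.
Qed.

Lemma conj_delta_surj w i (g' : G) :
  exists g, w * iota (delta i g) * w^-1 = iota (delta (act (eps w) i) g').
Proof.
case: wreathW => _ _ _ /(_ w i) E.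
have : summand iota (act (eps w) i) (iota (delta (act (eps w) i) g')).
  by exists g'.
by rewrite -E => -[_ [g _ <-] <-]; exists g.
Qed.

(** Conjugation may twist the values of [f] in an uncontrolled way; only the movement of its support
    by [eps w] is recorded. *)
Lemma conj_support w (s : seq I) (f : dsum I G) :
  (forall i, i \notin s -> f i = 1) ->
  exists f', iota f' = w * iota f * w^-1 /\
    forall i, i \notin [seq act (eps w) j | j <- s] -> f' i = 1.
Proof.
move=> fs; elim/(@dsum_list_ind I G): s f / fs
  => [|i s g f _ [f' [f'E f's]]].
  by exists 1; split=> [|i _]; rewrite ?mult1 ?mulg1 ?mulgV ?dsum1gE.
have [g' g'E] := conj_delta w i g.
exists (delta (act (eps w) i) g' * f'); split.
  by rewrite !gmulfM -g'E f'E !mulgA mulgVK.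
move=> k; rewrite /= inE negb_or => /andP[ki ks].
by rewrite dsum_mulgE deltaE (negbTE ki) mul1g f's.
Qed.

End Extension.

(** * The partition of the wreath-like product *)

Lemma FC_classes (H : groupType) : FC_group H ->
  exists cls : H -> seq H, forall x h, h * x * h^-1 \in cls x.
Proof.
move=> fc; have {}fc x := (finite_seqP _).1 (fc x).
have [cls clsP] := choice fc; exists cls => x h.
have : [set g * x * g^-1 | g in [set: H]] (h * x * h^-1) by exists h.
by rewrite clsP.
Qed.

Definition sandwich (X : groupType) (A E : seq X) : seq X :=
  [seq p.1 * z * p.2^-1 | p <- [seq (u, v) | u <- A, v <- A], z <- E].

Lemma mem_sandwich (X : groupType) (A E : seq X) u z v :
  u \in A -> z \in E -> v \in A -> u * z * v^-1 \in sandwich A E.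
Proof.
move=> uA zE vA.
by apply: (@allpairs_f _ _ _ (fun p z => p.1 * z * p.2^-1)
             _ _ (u, v)) => //; apply: allpairs_f.
Qed.

(** Every [x] equals [eta (g x) * iota (nu x) * eta (b x) * eta (be x)]: [be x] is the position of
    [eps x] in its small cell, [b x] that of the small centre in the large cell, and [g x] the large
    centre. Since [be] and [b] take finitely many values, a partition in terms of [nu] yields
    bounded cells. The ordinal bound rests on choosing [K] before [E1]. *)
Lemma wreath_partition (G H W : groupType) (I : choiceType)
    (act : H -> I -> I) (iota : {multiplicative dsum I G -> W})
    (eps : {multiplicative W -> H}) (eta : H -> W) (q : nat)
    (base : 'I_q -> I) (d n : nat) :
  is_left_action act -> wreath_like_product act iota eps ->
  orbit_base_points act base -> (forall h, eps (eta h) = h) ->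
  FC_group H -> group_asdim_le G d -> group_asdim_le H n ->
  forall E0 : seq W, exists2 K : nat, (d = 0%N -> K = 0%N) &
  forall E1 : seq W, exists (L : Type) (col : W -> nat) (lab : W -> L)
                            (B : seq W),
  [/\ forall x, (col x < n.+1 + K)%N,
      forall x x', col x = col x' -> lab x = lab x' -> x^-1 * x' \in B
    & forall x x', col x = col x' ->
        x^-1 * x' \in (if (col x < n.+1)%N then E0 else E1) ->
        lab x = lab x'].
Proof.
move=> [act1 actM] wreathW baseP epsK fcH asG asH E0.
have iota_inj : injective iota by case: wreathW.
have actK h : cancel (act h) (act h^-1).
  by move=> i; rewrite -actM mulVg act1.
have [colH [c [BH [cB cE]]]] := asH [seq eps x | x <- E0].
pose beta h := (c h)^-1 * h.
have betaB h : beta h \in BH := cB h.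
have [co coK] : exists co : W -> dsum I G, forall f, co (iota f) = f.
  exists (fun w => xget 1 [set f | iota f = w]) => f.
  apply: iota_inj.
  exact: (@xgetPex _ 1 [set g | iota g = iota f] (ex_intro _ f erefl)).
have [cls clsP] := FC_classes fcH.
pose step (E : seq W) := sandwich [seq eta u | u <- BH] E.
pose supp (E : seq W) := flatten [seq (finsupp (co w) : seq I) | w <- E].
have suppP E f i : iota f \in E -> i \notin supp E -> f i = 1.
  move=> fE iE; apply: fsfun_dflt; apply: contra iE => iE.
  by apply/flatten_mapP; exists (iota f); rewrite ?coK.
pose J0 := supp (step E0).
have /choice[orb orbP] i : exists a, exists h, act h (base a) = i.
  by have [a [h _]] := baseP i; exists a.
pose tr i j := xget 1 [set t | act t i = j].
have trP i j : orb i = orb j -> act (tr i j) i = j.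
  move=> ij; apply: (@xgetPex _ 1 [set t | act t i = j]).
  have [h hi] := orbP i; have [k kj] := orbP j.
  by exists (k * h^-1); rewrite /= actM -{1}hi actK ij kj.
have orb_act h i : orb (act h i) = orb i.
  have [k ki] := orbP i; have [l li] := orbP (act h i).
  have [a [_ au]] := baseP i.
  rewrite -(au (orb i)); last by exists k.
  by rewrite -(au (orb (act h i))) //; exists (h^-1 * l); rewrite actM li actK.
(* By the FC condition, all conjugates of the elements relating points of [J0] lie in a finite list.
   It bounds the neighbours within a window [act h J0] uniformly in [h], hence independently of
   [E1]. *)
pose Fc := flatten [seq cls t | t <- [seq tr i j | i <- J0, j <- J0]].
pose nb i := [seq act f i | f <- Fc].
have nbP h i j : i \in J0 -> j \in J0 -> orb i = orb j ->
    act h j \in nb (act h i).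
  move=> iJ jJ /trP ij; apply/mapP; exists (h * tr i j * h^-1).
    by apply/flatten_mapP; exists (tr i j) => //; apply: allpairs_f.
  by rewrite -actM mulgVK actM ij.
pose KT := ('I_(size Fc).+1 * 'I_q)%type.
pose T := ('I_n.+1 * KT * 'I_d.+1 * {ffun KT -> 'I_d.+1})%type.
(* The type [T] of the colours of cuts is built from [E0] alone. *)
exists (if d == 0%N then 0%N else #|{: T}|) => [/eqP -> //|E1].
pose E01 := E0 ++ E1.
(* When [x] makes a step in [E01], its small centre [cc x] moves by an element of this sandwich. *)
have [colV [cV [BV [cVB cVE]]]] := asH (sandwich BH [seq eps x | x <- E01]).
pose cc x := c (eps x).
pose g x := cV (cc x).
pose b x := (g x)^-1 * cc x.
have bB x : b x \in BV := cVB _.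
pose be x := beta (eps x).
pose nu x := co ((eta (g x))^-1 * x * (eta (be x))^-1 * (eta (b x))^-1).
have nuE x : iota (nu x) =
    (eta (g x))^-1 * x * (eta (be x))^-1 * (eta (b x))^-1.
  rewrite /nu; set w := _ * _ * _ * _.
  suff /(eps_ker wreathW)[f <-] : eps w = 1 by rewrite coK.
  rewrite /w !gmulfM !multV !epsK /be /beta /b -/(cc x) !invgM !invgK.
  by rewrite !mulgA !mulgK mulVg.
have nuD x x' : g x = g x' -> iota ((nu x)^-1 * nu x') =
    eta (b x) * (eta (be x) * (x^-1 * x') * (eta (be x'))^-1)
      * (eta (b x'))^-1.
  move=> gE; rewrite gmulfM multV !nuE gE !invgM !invgK !mulgA.
  by rewrite mulgK.
pose win h := [seq act h j | j <- J0].
pose E1' := sandwich [seq eta u | u <- BV] (step E01).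
pose J1 := supp E1'.
pose S1 := undup (J1 ++ flatten [seq win h | h <- BV]).
pose Q0 := 1 :: [seq co w i | w <- E1', i <- J1].
pose Q := Q0 ++ [seq z^-1 | z <- Q0].
have winS h : h \in BV -> {subset win h <= S1}.
  move=> hB i iw; rewrite mem_undup mem_cat; apply/orP; right.
  by apply/flatten_mapP; exists h.
have [col1 col1P] := @greedy_coloring _ (size Fc) nb S1
  (fun i => eq_leq (size_map _ _)).
pose kap i : KT := (col1 i, orb i).
have QV z : z \in Q -> z^-1 \in Q.
  rewrite !mem_cat => /orP[zQ|/mapP[y yQ ->]]; last by rewrite invgK yQ.
  by rewrite map_f ?orbT.
have rainbow h : h \in BV -> {in win h &, injective kap}.
  move=> hB i j iw jw [cij].
  move: (iw) (jw) => /mapP[i0 i0J iE] /mapP[j0 j0J jE].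
  rewrite {1}iE {1}jE !orb_act => oij.
  apply/eqP; apply: contraT => ij.
  have := col1P i j (winS _ hB _ iw) (winS _ hB _ jw) ij.
  rewrite cij eqxx iE jE => h'; apply: h'; exact: nbP.
have near_step x x' : x^-1 * x' \in E01 -> g x = g x' ->
    iota ((nu x)^-1 * nu x') \in E1'.
  move=> xx /nuD ->; apply: mem_sandwich; rewrite ?map_f //.
  by apply: mem_sandwich; rewrite ?map_f //; exact: betaB.
have near_Q x x' : x^-1 * x' \in E01 -> g x = g x' ->
    forall i, (nu x i)^-1 * nu x' i \in Q.
  move=> xx gE i; have := near_step _ _ xx gE; set f := _ * _ => fE.
  rewrite -dsum_invgE -dsum_mulgE -/f mem_cat; apply/orP; left.
  have [iJ|iJ] := boolP (i \in J1); last first.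
    by rewrite (suppP _ _ _ fE iJ) mem_head.
  by rewrite inE -[f]coK; apply/orP; right; exact: allpairs_f.
have ccg x x' : cc x = cc x' -> g x = g x' /\ b x = b x'.
  by rewrite /b /g => ->.
have eps_near x x' E : x^-1 * x' \in E ->
    (eps x)^-1 * eps x' \in [seq eps z | z <- E].
  by move=> xE; rewrite -multV -gmulfM; apply: map_f.
have F0 x x' : x^-1 * x' \in E0 -> colH (eps x) = colH (eps x') ->
  [/\ cc x = cc x', forall i, i \notin win (b x) -> nu x i = nu x' i
    & forall i, (nu x i)^-1 * nu x' i \in Q].
  move=> xx ee; have cx : cc x = cc x' by apply: cE => //; exact: eps_near.
  have [gE bE] := ccg _ _ cx.
  split=> // [i iw|i]; last by apply: near_Q => //; rewrite mem_cat xx.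
  have := nuD _ _ gE; rewrite -bE; set w0 := eta (be x) * _ * _ => fE.
  have w0E : w0 \in step E0.
    by apply: mem_sandwich; rewrite ?map_f //; exact: betaB.
  have /(eps_ker wreathW)[f0 f0E] : eps w0 = 1.
    rewrite /w0 !gmulfM !multV !epsK /be /beta !invgM !invgK -/(cc x) -/(cc x').
    by rewrite cx !mulgA mulgK mulgK mulVg.
  have f0J j : j \notin J0 -> f0 j = 1 by apply: suppP; rewrite f0E.
  (* The step of [nu] is the conjugate by [eta (b x)] of an element supported on [J0], so its
     support lies in the window. *)
  have [f1 [f1E f1w]] := conj_support wreathW (eta (b x)) f0J.
  apply/(mulgI (nu x i)^-1); rewrite mulVg; apply/esym.
  rewrite -dsum_invgE -dsum_mulgE.
  have -> : (nu x)^-1 * nu x' = f1 by apply: iota_inj; rewrite fE f1E f0E.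
  by apply: f1w; rewrite epsK.
have F1 x x' : x^-1 * x' \in E01 -> colV (cc x) = colV (cc x') ->
  [/\ g x = g x', forall i, i \notin S1 -> nu x i = nu x' i
    & forall i, (nu x i)^-1 * nu x' i \in Q].
  move=> xx ee.
  have gE : g x = g x'.
    apply: cVE => //; rewrite (_ : _ * _ =
        be x * ((eps x)^-1 * eps x') * (be x')^-1).
      by apply: mem_sandwich; rewrite ?betaB // eps_near.
    by rewrite /be /beta invgM invgK -!/(cc _) !mulgA mulgK mulgK.
  split=> // [i iS|]; last exact: near_Q.
  apply/(mulgI (nu x i)^-1); rewrite mulVg; apply/esym.
  rewrite -dsum_invgE -dsum_mulgE; apply: suppP (near_step _ _ xx gE) _.
  by apply: contra iS; rewrite mem_undup mem_cat => ->.
have [L [col [lab [BG [col_d col_inl col_inr colB]]]]] :=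
  core_partition asG QV (undup_uniq _) bB winS rainbow ccg F0 F1.
have [F FP] := dsum_finite S1 BG.
pose B := sandwich [seq (eta u)^-1 | u <- BH]
            (sandwich [seq (eta u)^-1 | u <- BV] [seq iota f | f <- F]).
pose code (t : 'I_n.+1 + T) := match t with inl a => a : nat
                          | inr t => (n.+1 + enum_rank (t : T))%N end.
have code_inj : injective code.
  move=> [s|s] [t|t] /= st.
  - by rewrite (ord_inj st).
  - by have := ltn_ord s; rewrite st ltnNge leq_addr.
  - by have := ltn_ord t; rewrite -st ltnNge leq_addr.
  by rewrite (enum_rank_inj (ord_inj (addnI st))).
exists L, (code \o col), lab, B.
split=> [x|x x' /code_inj colE labE|x x' /code_inj].
- rewrite /=; case cx: (col x) => [t|t] /=; first exact: ltn_addr.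
  by rewrite ltn_add2l (gtn_eqF (col_d _ _ cx)).
- have [gE bE nu_out nu_in] := colB _ _ colE labE.
  have fF : (nu x)^-1 * nu x' \in F.
    apply: FP => i; rewrite dsum_mulgE dsum_invgE.
      move=> iS; rewrite nu_out ?mulVg //; apply: contra iS.
      exact: winS.
    have [iw|iw] := boolP (i \in win (b x)).
      by rewrite inE nu_in ?orbT.
    by rewrite nu_out // mulVg mem_head.
  have -> : x^-1 * x' = (eta (be x))^-1 * ((eta (b x))^-1
      * iota ((nu x)^-1 * nu x') * (eta (b x'))^-1^-1) * (eta (be x'))^-1^-1.
    by rewrite nuD // !invgK !mulgA !mulgVK mulVg mul1g.
  have etaV u (A : seq H) : u \in A -> (eta u)^-1 \in [seq (eta v)^-1 | v <- A].
    exact: (@map_f _ _ (fun v => (eta v)^-1)).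
  apply: mem_sandwich; [exact/etaV/betaB| |exact/etaV/betaB].
  by apply: mem_sandwich; [exact/etaV|exact: map_f|exact/etaV].
rewrite /=; case cx: (col x) => [t|t] /= /esym cx'.
  by rewrite ltn_ord; exact: col_inl cx cx'.
rewrite ltnNge leq_addr /= => xx.
by apply: col_inr cx cx' _; rewrite mem_cat xx orbT.
Qed.

End Groups.

(** * Ordinals *)

Section Ordinals.
Set Implicit Arguments.
Unset Strict Implicit.
Local Open Scope fset_scope.

(** Passing to a link removes one element from each set, so the size bound drops by one with each
    successor. *)
Lemma Ord_le_finite (alpha : ord) k (M : set {fset nat}) :
  (forall s, M s -> (0 < #|` s| <= k)%N) ->
  Ord_le (oadd alpha (onat k)) M.
Proof.
elim: k M => [|k IH] M MP.
  left; apply/seteqP; split=> // s /MP /andP[s0].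
  by rewrite leqNgt s0.
right => a; exists (inr tt); apply: IH => s [s0 Ms as_].
rewrite cardfs_gt0 s0 /=.
by have /andP[_] := MP _ Ms; rewrite cardfsU1 as_.
Qed.

(** The tail [onat n] is spent on the first [n] elements. The next element determines [K] and thus
    the predecessor [omega * m + K] of [omega * m.+1]; at most [K] elements remain. *)
Lemma Ord_le_omegaS (m n : nat) (M : set {fset nat}) :
  (forall s, M s -> (0 < #|` s|)%N) ->
  (forall s0, #|` s0| = n.+1 -> exists K, forall s, M s -> s0 `<=` s ->
     (#|` s| <= n.+1 + K)%N) ->
  Ord_le (oadd (omul omega (onat m.+1)) (onat n)) M.
Proof.
elim: n M => [|n IH] M M0 MP; right => a.
  have [K KP] := MP [fset a] (cardfs1 a).
  exists (inl (tt, K)); apply: Ord_le_finite => s [s0 Ms as_].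
  rewrite cardfs_gt0 s0 /=.
  by have := KP _ Ms (fsubsetUl _ _); rewrite cardfsU1 as_ leq_add2l.
exists (inr tt); apply: IH => [s [s0 _ _]|s0 cs0]; first by rewrite cardfs_gt0.
have [as0|as0] := boolP (a \in s0).
  by exists 0%N => s [_ _ as_] /fsubsetP/(_ _ as0); rewrite (negbTE as_).
have [|K KP] := MP (a |` s0); first by rewrite cardfsU1 as0 cs0.
exists K => s [_ Ms as_] ss.
by have := KP _ Ms (fsetUS _ ss); rewrite cardfsU1 as_.
Qed.

End Ordinals.

(** * Metrics *)

Section Metrics.
Set Implicit Arguments.
Unset Strict Implicit.
Import Order.TTheory GRing.Theory Num.Theory.
Local Open Scope ring_scope.

(** * Word metrics in terms of finite sets *)

Section Metric.
Context {R : realType} {X : groupType}.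
Implicit Types (A : set (X * R)) (x : X).

Definition proper_generators A : Prop :=
  [/\ forall x, words A x !=set0,
      forall p, A p -> 0 <= p.2,
      forall p, A p -> p.2 = 0 -> p.1 = 1%g
    & forall N : R, finite_set [set p | A p /\ p.2 <= N]].

Lemma positive_lower_bound (s : seq R) :
  exists2 delta : R, 0 < delta & forall t, t \in s -> 0 < t -> delta <= t.
Proof.
elim: s => [|a s [e e0 h]]; first by exists 1.
exists (if 0 < a then Num.min a e else e) => [|x]; last rewrite inE.
  by case: ifP => // a0; rewrite lt_min a0.
case/predU1P => [-> ->|xs x0]; first by rewrite ge_min lexx.
by case: ifP => _; rewrite ?ge_min h ?orbT.
Qed.

Lemma strict_bound (f : X -> R) (s : seq X) :
  exists2 r : R, 0 < r & forall x, x \in s -> f x < r.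
Proof.
elim: s => [|a s [r r0 h]]; first by exists 1.
exists (Num.max r (f a + 1)) => [|x]; first by rewrite lt_max r0.
rewrite inE lt_max => /predU1P[->|/h ->//]; rewrite ltrDl ltr01.
by rewrite orbT.
Qed.

Lemma weight_ge0 A s x : proper_generators A -> words A x s ->
  forall p, p \in s -> 0 <= p.2.
Proof.
by move=> [_ A0 _ _] [sA _] p /sA[/A0//|/A0].
Qed.

(** Finitely many generators weigh at most [r], so their positive weights are at least some [delta].
    Weightless letters are trivial, and a word lighter than [delta * k.+1] has at most [k] other
    letters. *)
Lemma light_words A (r : R) : proper_generators A ->
  exists (delta : R) (Q : seq X), 0 < delta /\
  forall k x s, words A x s -> (forall p, p \in s -> p.2 <= r) ->
    \sum_(p <- s) p.2 < delta * k.+1%:R -> x \in word_ball Q k.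
Proof.
move=> propA; have [_ A0 A1 Afin] := propA.
have /finite_seqP[l lP] := Afin r.
have [delta delta0 deltaP] := positive_lower_bound [seq p.2 | p <- l].
exists delta, ([seq p.1 | p <- l] ++ [seq (p.1)^-1%g | p <- l]).
split=> // k x s; elim/last_ind: s k x => [|s p IH] k x xs sr.
  move=> _; case: xs => _; rewrite big_nil => <-.
  by apply: (@word_ball_le _ _ 0 k); rewrite ?inE.
rewrite -cats1 big_cat big_seq1 /=.
have p_s : p \in rcons s p by rewrite mem_rcons mem_head.
have s_s z : z \in s -> z \in rcons s p.
  by rewrite mem_rcons inE => ->; rewrite orbT.
have sum0 : 0 <= \sum_(z <- s) z.2.
  by rewrite big_seq sumr_ge0 // => z /s_s; exact: weight_ge0 xs z.
have p0 : 0 <= p.2 := weight_ge0 propA xs p_s.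
have [sA xE] := xs.
have ws : words A (\prod_(z <- s) z.1)%g s.
  by split=> // z /s_s /sA.
have xE' : x = ((\prod_(z <- s) z.1)%g * p.1)%g.
  by rewrite -xE -cats1 big_cat big_seq1.
have pl : (p \in l) || (((p.1)^-1%g, p.2) \in l).
  have pr := sr _ p_s.
  have [Ap|Ap] := sA _ p_s.
    by have : [set q | A q /\ q.2 <= r] p by []; rewrite lP /= => ->.
  have : [set q | A q /\ q.2 <= r] ((p.1)^-1%g, p.2) by [].
  by rewrite lP /= => ->; rewrite orbT.
have sr' z : z \in s -> z.2 <= r by move=> /s_s /sr.
have [pz|pz] := eqVneq p.2 0.
  rewrite pz addr0 => lt; rewrite xE'.
  suff -> : p.1 = 1%g by rewrite mulg1; exact: IH ws sr' lt.
  have [Ap|Ap] := sA _ p_s; first exact: A1 Ap pz.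
  by apply: invg_inj; rewrite invg1; exact: A1 Ap pz.
have dp : delta <= p.2.
  apply: deltaP; last by rewrite lt_def pz.
  case/orP: pl => pl; first exact: (map_f snd pl).
  exact: (map_f snd pl).
move=> lt.
have {}lt : \sum_(z <- s) z.2 < delta * k%:R.
  rewrite -(ltrD2r p.2) (lt_le_trans lt) //.
  by rewrite -natr1 mulrDr mulr1 lerD2l.
case: k lt => [|k] lt; first by move: lt; rewrite mulr0 ltNge sum0.
rewrite xE'; apply: word_ballM; first exact: IH ws sr' lt.
rewrite mem_cat; case/orP: pl => pl; apply/orP; [left|right].
  exact: (map_f fst pl).
by rewrite -(invgK p.1); exact: (map_f (fun q => (q.1)^-1%g) pl).
Qed.

Lemma word_length_ltP A x r : proper_generators A -> word_length A x < r ->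
  exists s, [/\ words A x s, \sum_(p <- s) p.2 < r &
                forall p, p \in s -> p.2 <= r].
Proof.
move=> propA lt; have [ne _ _ _] := propA.
have [|y [s ws <-] lt'] := inf_lt _ lt; first by apply: image_nonempty.
exists s; split=> // p ps; apply: le_trans (ltW lt').
rewrite (big_rem p) //= lerDl big_seq sumr_ge0 // => q /mem_rem.
exact: weight_ge0 ws q.
Qed.

Lemma word_length_ge0 A x : proper_generators A -> 0 <= word_length A x.
Proof.
move=> propA; have [ne _ _ _] := propA.
apply: lb_le_inf; first by apply: image_nonempty.
move=> _ [s ws <-]; rewrite big_seq sumr_ge0 // => p.
exact: weight_ge0 ws p.
Qed.

Lemma word_length_eq0 A x : proper_generators A -> word_length A x = 0 ->
  x = 1%g.
Proof.
move=> propA x0; have [delta [Q [delta0 QP]]] := light_words 1 propA.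
have [s [ws lt s1]] : exists s, [/\ words A x s,
    \sum_(p <- s) p.2 < Num.min delta 1 &
    forall p, p \in s -> p.2 <= Num.min delta 1].
  by apply: word_length_ltP => //; rewrite x0 lt_min delta0 ltr01.
have : x \in word_ball Q 0.
  apply: QP ws _ _; first by move=> p /s1; rewrite le_min => /andP[].
  by move: lt; rewrite lt_min mulr1 => /andP[].
by rewrite inE => /eqP.
Qed.

Lemma finite_balls A (r : R) : proper_generators A ->
  exists B : seq X, forall x, word_length A x < r -> x \in B.
Proof.
move=> propA; have [delta [Q [delta0 QP]]] := light_words r propA.
exists (word_ball Q (Num.bound (`|r| / delta))) => x lt.
have [s [ws lt' sr]] := word_length_ltP propA lt.
apply: QP ws sr _; apply: lt_trans lt' _.
rewrite mulrC -ltr_pdivrMr //; apply: le_lt_trans (_ : `|r| / delta < _).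
  by rewrite ler_pM2r ?invr_gt0 // ler_norm.
apply: lt_trans (archi_boundP _) _; first by rewrite divr_ge0 // ltW.
by rewrite ltr_nat.
Qed.

Lemma asdim_group_asdim A n : proper_generators A ->
  asdim_le (word_dist A) n -> group_asdim_le X n.
Proof.
move=> propA asX E.
have [r r0 rP] := strict_bound (word_length A) E.
have [U [UP Ucov]] := asX _ r0.
have /choice[cell cellP] g : exists c : 'I_n.+1 * set X, U c.1 c.2 /\ c.2 g.
  have : Union (\bigcup_i U i) g by rewrite Ucov.
  by case=> V [i _ UV] Vg; exists (i, V).
have /choice[B BP] i : exists B : seq X, forall V x y, U i V -> V x -> V y ->
    (x^-1 * y)%g \in B.
  have [[s s0 sP] _] := UP i; have [B BP] := finite_balls (s + 1) propA.
  exists B => V x y UV Vx Vy; apply: BP.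
  apply: le_lt_trans (_ : s < _); last by rewrite ltrDl.
  have /ereal_supP h := sP _ UV; rewrite -lee_fin; apply: h.
  by exists (x, y).
(* [xget] depends on the set only, so points with the same chosen cell get the same centre. *)
exists (fun g => (cell g).1), (fun g => xget 1%g (cell g).2),
  (flatten [seq B i | i <- enum 'I_n.+1]); split.
  move=> g; have [cU cg] := cellP g; apply/flatten_mapP.
  exists (cell g).1; rewrite ?mem_enum //.
  by apply: (BP _ _ _ _ cU _ cg); exact: xgetI cg.
move=> g g' col_eq gE; congr (xget _ _); apply: contrapT => ne.
have [cU cg] := cellP g; have [cU' cg'] := cellP g'.
have [_ disj] := UP (cell g).1.
rewrite -col_eq in cU'.
have := disj _ _ cU cU' ne; apply/negP; rewrite -ltNge.
apply: le_lt_trans (_ : (word_dist A g g')%:E < _)%E; last first.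
  by rewrite lte_fin; exact: rP.
by apply: ereal_inf_lbound; exists (g, g').
Qed.

(** The way back to metric families: their members are the joint fibres of [col] and [lab]. *)
Lemma cell_families A (L : Type) (col : X -> nat) (lab : X -> L) (B : seq X) :
  proper_generators A ->
  (forall x x', col x = col x' -> lab x = lab x' -> (x^-1 * x')%g \in B) ->
  exists U : nat -> set (set X),
  [/\ forall i, uniformly_bounded (word_dist A) (U i),
      forall i r, (forall x x', col x = i -> col x' = i ->
          word_length A (x^-1 * x')%g < r -> lab x = lab x') ->
        disjoint_family (word_dist A) r (U i)
    & forall x, exists2 V, U (col x) V & V x].
Proof.
move=> propA colB.
pose cell x := [set y | col y = col x /\ lab y = lab x].
exists (fun i => [set V | exists2 x, col x = i & V = cell x]); split.
- have [r r0 rP] := strict_bound (word_length A) B.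
  move=> i; exists r => // _ [x _ ->]; apply/ereal_supP.
  move=> _ [[y z] [/= [cy ly] [cz lz]] <-]; rewrite lee_fin ltW //.
  by apply: rP; apply: colB; rewrite ?cy ?ly.
- move=> i r h _ _ [x xi ->] [y yi ->] ne; apply/ereal_infP.
  move=> _ [[u v] [/= [cu lu] [cv lv]] <-]; rewrite lee_fin leNgt.
  apply/negP => lt; apply: ne.
  rewrite /cell xi yi -lu -lv (h u v) ?cu ?cv //.
by move=> x; exists (cell x) => //; exists x.
Qed.

End Metric.

(** * The metric of the wreath-like product *)

Section WreathMetric.
Context {R : realType}.

Lemma proper_weighted (G : groupType) (S : set G) (w : G -> R) :
  proper_weighted_generators S w -> proper_generators (weighted S w).
Proof.
move=> [gen w0 w1 fin]; split=> // [_ [s Ss <-]|_ [s Ss <-]|N] /=.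
- exact: w0.
- exact: w1.
apply: sub_finite_set (finite_image (fun s => (s, w s)) (fin N)).
by move=> _ [[s Ss <-] wN]; exists s.
Qed.

Lemma words1 (X : groupType) (A : set (X * R)) : words A 1%g [::].
Proof. by split; rewrite ?big_nil. Qed.

Lemma wordsM (X : groupType) (A : set (X * R)) x y s t :
  words A x s -> words A y t -> words A (x * y)%g (s ++ t).
Proof.
move=> [sA <-] [tA <-]; split; last by rewrite big_cat.
by move=> p; rewrite mem_cat => /orP[/sA|/tA].
Qed.

(** Conjugating the base-point generators by the [eta h] reaches every coordinate, and the direct
    sum together with the [eta h] generates W. Finiteness comes from the balls of G and H, there
    being finitely many base points. *)
Lemma wreath_generators_proper (G H W : groupType) (I : choiceType)
    (act : H -> I -> I) (iota : {multiplicative dsum I G -> W})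
    (eps : {multiplicative W -> H}) (eta : H -> W) (q : nat)
    (base : 'I_q -> I) (SG : set G) (wG : G -> R) (AH : set (H * R)) :
  wreath_like_product act iota eps ->
  orbit_base_points act base -> (forall h, eps (eta h) = h) -> unital eta ->
  proper_weighted_generators SG wG -> proper_generators AH ->
  proper_generators (wreath_generators iota eta base SG
    (word_length (weighted SG wG)) (word_length AH)).
Proof.
move=> wreathW baseP epsK eta1 propSG propAH.
have propG := proper_weighted propSG.
set A := wreath_generators _ _ _ _ _ _.
split.
- pose gen x := words A x !=set0.
  have genM x y : gen x -> gen y -> gen (x * y)%g.
    by move=> [s ws] [t wt]; exists (s ++ t); exact: wordsM.
  have gen_letter x w : A (x, w) -> gen x /\ gen x^-1%g.
    move=> Ax; split; [exists [:: (x, w)]|exists [:: (x^-1%g, w)]].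
      by split=> [p|]; rewrite ?big_seq1 // inE => /eqP ->; left.
    split=> [p|]; rewrite ?big_seq1 // inE => /eqP -> /=.
    by right; rewrite invgK.
  have gen_eta h : gen (eta h) /\ gen (eta h)^-1%g.
    apply: (gen_letter _ (word_length AH h)); right; exists h => //.
    by rewrite /wreath_elt mult1 mul1g.
  have gen_base a g : gen (iota (delta (base a) g)).
    have gen_s s : SG s -> gen (iota (delta (base a) s)) /\
                           gen (iota (delta (base a) s))^-1%g.
      move=> Ss; apply: (gen_letter _ (word_length (weighted SG wG) s)); left.
      by exists a, s; split=> //; rewrite /wreath_elt eta1 mulg1.
    have [ne _ _ _] := propG; have [s [sA <-]] := ne g.
    elim: s sA => [|p s IH] sA.
      by rewrite big_nil delta1 mult1; exists [::]; exact: words1.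
    rewrite big_cons deltaM gmulfM; apply: genM; last first.
      by apply: IH => z zs; apply: sA; rewrite inE zs orbT.
    have [[s0 Ss0 <-]|[s0 Ss0 [s0E _]]] := sA p (mem_head _ _).
      by have [] := gen_s _ Ss0.
    have [_] := gen_s _ Ss0; rewrite -multV s0E; congr (gen (iota _)).
    apply/fsfunP => k; rewrite dsum_invgE !deltaE.
    by case: eqP; rewrite ?invgK ?invg1.
  have gen_delta i g : gen (iota (delta i g)).
    have [a [[h <-] _]] := baseP i.
    have [g0] := conj_delta_surj wreathW (eta h) (base a) g.
    rewrite epsK => <-; have [e1 e2] := gen_eta h.
    by apply: (genM) => //; exact: genM.
  have gen_iota f : gen (iota f).
    elim/(@dsum_ind I G): f => [|i g f _ IH].
      by rewrite mult1; exists [::]; exact: words1.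
    by rewrite gmulfM; exact: genM.
  move=> x; have /(eps_ker wreathW)[f fE] : eps (x * (eta (eps x))^-1)%g = 1%g.
    by rewrite gmulfM multV epsK mulgV.
  rewrite -[x](mulgVK (eta (eps x))) -fE; apply: genM => //.
  by have [] := gen_eta (eps x).
- move=> _ [[a [s [_ ->]]]|[h _ <-]]; exact: word_length_ge0.
- move=> _ [[a [s [_ ->]]]|[h _ <-]] /= /word_length_eq0 ->//.
    by rewrite /wreath_elt delta1 mult1 eta1 mulg1.
  by rewrite /wreath_elt mult1 eta1 mulg1.
- move=> N.
  have [BG BGP] := finite_balls (N + 1) propG.
  have [BH BHP] := finite_balls (N + 1) propAH.
  have ltN t : t <= N -> t < N + 1.
    by move=> tN; apply: le_lt_trans tN _; rewrite ltrDl.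
  pose gG a s := (wreath_elt iota eta (delta (base a) s) 1%g,
                  word_length (weighted SG wG) s).
  pose gH h := (wreath_elt iota eta 1%g h, word_length AH h).
  apply: sub_finite_set (finite_seq ([seq gG a s | a <- enum 'I_q, s <- BG] ++
                                     [seq gH h | h <- BH])).
  move=> p [[[a [s [Ss ->]]]|[h _ <-]] /= pN]; rewrite mem_cat; apply/orP.
    left; apply: (@allpairs_f _ _ _ gG); rewrite ?mem_enum //.
    exact/BGP/ltN.
  by right; apply: (@map_f _ _ gH); apply/BHP/ltN.
Qed.

Definition two_scale_families (X : Type) (dX : X -> X -> R) (n K : nat)
    (r0 r1 : R) : Prop :=
  exists U : nat -> set (set X),
  [/\ forall i, uniformly_bounded dX (U i),
      forall i, (i <= n)%N -> disjoint_family dX r0 (U i),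
      forall i, (n < i)%N -> disjoint_family dX r1 (U i)
    & forall x, exists i, (i < n.+1 + K)%N /\ exists2 V, U i V & V x].

Lemma wreath_families (G H W : groupType) (I : choiceType)
    (act : H -> I -> I) (iota : {multiplicative dsum I G -> W})
    (eps : {multiplicative W -> H}) (eta : H -> W) (q : nat)
    (base : 'I_q -> I) (d n : nat) (A : set (W * R)) :
  is_left_action act -> wreath_like_product act iota eps ->
  orbit_base_points act base -> (forall h, eps (eta h) = h) ->
  FC_group H -> group_asdim_le G d -> group_asdim_le H n ->
  proper_generators A ->
  forall r0, exists2 K, (d = 0%N -> K = 0%N) &
    forall r1, two_scale_families (word_dist A) n K r0 r1.
Proof.
move=> actP wreathW baseP epsK fcH asG asH propA r0.
have [B0 B0P] := finite_balls r0 propA.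
have [K K0 KP] := wreath_partition actP wreathW baseP epsK fcH asG asH B0.
exists K => // r1; have [B1 B1P] := finite_balls r1 propA.
have [L [col [lab [B [colK colB colE]]]]] := KP B1.
have [U [Ub Ud Uc]] := cell_families propA colB.
exists U; split=> // [i ni|i ni|x].
- apply: Ud => x x' xi x'i lt; apply: colE; rewrite ?xi ?x'i // ltnS ni.
  exact: B0P.
- apply: Ud => x x' xi x'i lt; apply: colE; rewrite ?xi ?x'i // ltnS leqNgt ni.
  exact: B1P.
by exists (col x); split=> //; exact: Uc.
Qed.

End WreathMetric.

(** * Dimension bounds from two-scale families *)

Section Dimension.
Context {R : realType} {X : Type} (dX : X -> X -> R).

Lemma disjoint_family_le (r r' : R) F : r <= r' ->
  disjoint_family dX r' F -> disjoint_family dX r F.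
Proof.
by move=> rr h U V FU FV UV; apply: le_trans (h _ _ FU FV UV); rewrite lee_fin.
Qed.

(** Otherwise [s] could index all families, with [r1] its maximum: [s0] is listed first and takes
    the [n.+1] families of scale [rho], the rest of [s] those of scale [r1]. *)
Lemma A_sets_card (n K rho : nat) :
  (forall r1, two_scale_families dX n K rho%:R r1) ->
  forall s0 s : {fset nat}, #|` s0|%fset = n.+1 ->
    (forall i, i \in s0 -> (i <= rho)%N) ->
    A_sets dX s -> (s0 `<=` s)%fset -> (#|` s|%fset < n.+1 + K)%N.
Proof.
move=> fams s0 s cs0 s0_le [_ not_cov] s0s; rewrite ltnNge; apply/negP => cs.
apply: not_cov; have [U [Ub U0 U1 Uc]] := fams (\max_(i <- s) i)%:R.
pose e := (s0 : seq nat) ++ (s `\` s0)%fset.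
have ue : uniq e.
  rewrite cat_uniq !fset_uniq andbT /=; apply/hasPn => i.
  by rewrite inE => /andP[].
have es i : (i \in e) = (i \in s).
  rewrite mem_cat inE; have [is0|] //= := boolP (i \in s0).
  by rewrite (fsubsetP s0s).
have se : size e = #|` s|%fset := perm_size (uniq_perm ue (fset_uniq s) es).
exists (fun i => U (index i e)); split=> [i is_|].
  split=> //; have [is0|is0] := boolP (i \in s0).
    apply: disjoint_family_le (U0 _ _); first by rewrite ler_nat s0_le.
    by rewrite -ltnS -cs0 index_cat is0 index_mem.
  apply: disjoint_family_le (U1 _ _).
    by rewrite ler_nat (big_rem i) //= leq_maxl.
  by rewrite index_cat (negbTE is0) -[X in (X <= _)%N]cs0 leq_addr.
apply/seteqP; split=> // x _; have [j [jK [V UV Vx]]] := Uc x.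
have js : (j < size e)%N by rewrite se; exact: leq_trans jK cs.
exists V => //; exists (nth 0%N e j); first by rewrite /= -es mem_nth.
by rewrite index_uniq.
Qed.

Lemma trasdim_le_finite n :
  (forall r0, forall r1, two_scale_families dX n 0 r0 r1) ->
  trasdim_le dX (oadd (omul omega (onat 0)) (onat n)).
Proof.
move=> fams; apply: Ord_le_finite => s As; have [s0 _] := As.
rewrite cardfs_gt0 s0 /= leqNgt; apply/negP => ns.
have [t ts ct] : exists2 t : {fset nat}, (t `<=` s)%fset & #|` t|%fset = n.+1.
  exists [fset i in take n.+1 s]%fset.
    by apply/fsubsetP => i; rewrite !inE => /mem_take.
  by rewrite card_fseq undup_id ?take_uniq ?fset_uniq // size_takel.
have t_le i : i \in t -> (i <= \max_(i <- s) i)%N.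
  by move=> it; rewrite (big_rem i) ?leq_maxl // (fsubsetP ts).
by have := A_sets_card (fams _) ct t_le As ts; rewrite addn0 ltnNge ns.
Qed.

Lemma trasdim_le_omegaS m n :
  (forall r0, exists K, forall r1, two_scale_families dX n K r0 r1) ->
  trasdim_le dX (oadd (omul omega (onat m.+1)) (onat n)).
Proof.
move=> fams; apply: Ord_le_omegaS => [s [s0 _]|t ct].
  by rewrite cardfs_gt0.
have [K KP] := fams (\max_(i <- t) i)%:R.
exists K => s As ts; apply: ltnW; apply: A_sets_card KP _ _ ct _ As ts => i it.
by rewrite (big_rem i) ?leq_maxl.
Qed.

(** The scales [r n] and [r (n + K)] dominate those required of the first [n.+1] and of the
    remaining [K] families. *)
Lemma two_scale_property_C n :
  (forall r0, exists K, forall r1, two_scale_families dX n K r0 r1) ->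
  asymptotic_property_C dX.
Proof.
move=> fams r r0 rS; have [K KP] := fams (r n).
have [U [Ub U0 U1 Uc]] := KP (r (n + K)%N).
have rle i j : (i <= j)%N -> r i <= r j.
  by rewrite leq_eqVlt => /predU1P[->//|/rS/ltW].
exists (n + K)%N, (fun i => U i); split=> [i|].
  split=> //; have [ni|ni] := leqP i n.
    exact: disjoint_family_le (rle _ _ ni) (U0 _ ni).
  by apply: disjoint_family_le (U1 _ ni); apply: rle; rewrite -ltnS.
apply/seteqP; split=> // x _; have [j [jK [V UV Vx]]] := Uc x.
by exists V => //; exists (Ordinal jK).
Qed.

(** For [m = 0] there is no index [i], so the single family of [C] covers by itself. *)
Lemma DTUT00_asdim : DTUT dX 0 0 -> asdim_le dX 0.
Proof.
move=> [F FP] r r0; pose k := Num.bound r.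
have rk : r <= k.+1%:R.
  apply: ltW; apply: lt_trans (archi_boundP (ltW r0)) _.
  by rewrite ltr_nat.
have [||i j|C [D [CP _]]] := FP (fun=> 1%N) (fun=> k.+1) => //.
  by rewrite !ord1.
have [|Cd _ Ccov] := CP [ffun=> 0%N]; first by case.
exists (C [ffun=> 0%N]); split=> [i|].
  have [Cb Ck] := Cd i; split=> //.
  exact: disjoint_family_le rk Ck.
rewrite /covers -Ccov; congr Union; apply/seteqP; split=> U; first by left.
by case=> // -[[]].
Qed.

End Dimension.

End Metrics.

Theorem theoremA (R : realType) (m : nat) (G H : groupType)
    (countG : countable [set: G]) (countH : countable [set: H])
    (SG : set G) (wG : G -> R) (SH : set H) (wH : H -> R)
    (properG : proper_weighted_generators SG wG)
    (properH : proper_weighted_generators SH wH) :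
  let lG := word_length (weighted SG wG) in
  let lH := word_length (weighted SH wH) in
  let dG := word_dist (weighted SG wG) in
  let dH := word_dist (weighted SH wH) in
  forall (asdimG : finite_asdim dG) (dtutG : DTUT dG m 0)
    (fcH : FC_group H) (asdimH : finite_asdim dH)
    (W : groupType) (I : choiceType) (act : H -> I -> I)
    (actP : is_left_action act)
    (iota : {multiplicative dsum I G -> W}) (eps : {multiplicative W -> H})
    (wreathW : wreath_like_product act iota eps)
    (q : nat) (base : 'I_q -> I) (baseP : orbit_base_points act base)
    (T : set W) (transT : coset_transversal iota T) (symT : symmetric_set T)
    (eta : H -> W) (etaP : transversal_map eps T eta) (eta1 : unital eta),
  let dW := word_dist (wreath_generators iota eta base SG lG lH) in
  forall bornEta : bornologous dH dW eta,
  (forall n : nat, asdim_eq dH n ->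
     trasdim_le dW (oadd (omul omega (onat m)) (onat n))) /\
  asymptotic_property_C dW.
Proof.
move=> lG lH dG dH [d asG] dtutG fcH [n0 asH0] W I act actP iota eps wreathW
  q base baseP T _ _ eta etaP eta1 dW _.
have epsK h : eps (eta h) = h by case: (etaP h).
have propG := proper_weighted properG.
have propH := proper_weighted properH.
have propW := wreath_generators_proper wreathW baseP epsK eta1 properG propH.
have fams d' n : asdim_le dG d' -> asdim_le dH n ->
    forall r0, exists2 K, (d' = 0%N -> K = 0%N) &
      forall r1, two_scale_families dW n K r0 r1.
  move=> /(asdim_group_asdim propG) aG /(asdim_group_asdim propH) aH.
  exact: wreath_families actP wreathW baseP epsK fcH aG aH propW.
split; last first.
  apply: (@two_scale_property_C _ _ _ n0) => r0.
  by have [K _ KP] := fams _ _ asG asH0 r0; exists K.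
(* For [m = 0] the DTUT property gives asymptotic dimension 0 of G, hence [K = 0]; otherwise one
   factor [omega] absorbs [K]. *)
move=> n [asH _]; case: m dtutG => [/DTUT00_asdim asG0|m _].
  apply: trasdim_le_finite => r0 r1.
  by have [K /(_ erefl) -> KP] := fams _ _ asG0 asH r0.
apply: trasdim_le_omegaS => r0.
by have [K _ KP] := fams _ _ asG asH r0; exists K.
Qed.
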